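(* Let $t$ be a binary tree pattern. Let $\mathrm{En}_{L,t}(x,y) = \sum_{T} x^{v(T)} y^{c_t(T)}$, where the sum is over all (finite) binary trees $T$, $v(T)$ denotes the number of vertices of $T$, and $c_t(T)$ denotes the number of copies of $t$ in $T$. Then $\mathrm{En}_{L,t}(x,y)$ is algebraic, i.e. there is a nonzero polynomial $P(x,y,f)$ with rational (indeed polynomial) coefficients in $x,y$ such that $P(x,y,\mathrm{En}_{L,t}(x,y)) = 0$.
   Context: All trees are rooted and ordered. A binary tree is a finite rooted ordered tree in which every vertex has either $0$ children (a leaf) or exactly $2$ ordered children (left and right); the single-vertex tree is a binary tree. A binary tree pattern is a binary tree $t$ whose leaves are regarded as blanks that can be filled by arbitrary binary trees. A binary tree $T$ matches the pattern $t$ at a vertex $u$ of $T$ if there is a map $\phi$ from the vertices of $t$ to the vertices of $T$ sending the root of $t$ to $u$ such that for every internal (non-leaf) vertex $w$ of $t$, $\phi(w)$ is an internal vertex of $T$ and $\phi$ sends the left (resp. right) child of $w$ to the left (resp. right) child of $\phi(w)$; leaves of $t$ may be sent to any vertex (leaf or internal) of $T$. Equivalently, the subtree of $T$ rooted at $u$ is obtained from $t$ by replacing each leaf of $t$ by some binary tree. The number of copies of $t$ in $T$ is the number of vertices $u$ of $T$ at which $T$ matches $t$. (In particular, if $t$ is the one-vertex pattern, every vertex of $T$ is a copy.) *)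

(* Defs.v *)
From HB Require Import structures.
From mathcomp Require Import all_boot all_order all_algebra.
From mathcomp Require Import boolp classical_sets cardinality fsbigop.

Set Implicit Arguments.
Unset Strict Implicit.
Unset Printing Implicit Defensive.
Import Order.TTheory GRing.Theory.
Local Open Scope ring_scope.

Inductive bintree : Type := Leaf | Node of bintree & bintree.

Fixpoint gentree_of_bintree (T : bintree) : GenTree.tree unit :=
  if T is Node l r then
    GenTree.Node 1 [:: gentree_of_bintree l; gentree_of_bintree r]
  else GenTree.Node 0 [::].

Fixpoint bintree_of_gentree (g : GenTree.tree unit) : option bintree :=
  match g with
  | GenTree.Node 0 [::] => Some Leaf
  | GenTree.Node 1 [:: gl; gr] =>
      if (bintree_of_gentree gl, bintree_of_gentree gr) is (Some l, Some r)
      then Some (Node l r) else None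
  | _ => None
  end.

Lemma gentree_of_bintreeK : pcancel gentree_of_bintree bintree_of_gentree.
Proof. by elim=> //= l -> r ->. Qed.

HB.instance Definition _ := Countable.copy bintree (pcan_type gentree_of_bintreeK).

(* A vertex is named by its address, the list of turns leading to it from the
   root (false = left, true = right). *)
Fixpoint addresses (T : bintree) : seq (seq bool) :=
  if T is Node l r then
    [::] :: [seq false :: a | a <- addresses l]
         ++ [seq true :: a | a <- addresses r]
  else [:: [::]].

Definition vertex (T : bintree) : finType := seq_sub (addresses T).

Lemma root_subproof (T : bintree) : [::] \in addresses T.
Proof. by case: T. Qed.

Definition root_vertex (T : bintree) : vertex T := SeqSub (root_subproof T).

Definition is_child (T : bintree) (b : bool) (u v : vertex T) : bool :=
  val v == rcons (val u) b.

Definition internal (T : bintree) (u : vertex T) : bool :=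
  [exists b, exists v, is_child b u v].

Definition matches_at (t T : bintree) (u : vertex T) : Prop :=
  exists phi : vertex t -> vertex T,
    phi (root_vertex t) = u /\
    forall w : vertex t, internal w ->
      internal (phi w) /\
      forall (b : bool) (w' : vertex t),
        is_child b w w' -> is_child b (phi w) (phi w').

Definition nverts (T : bintree) : nat := #|vertex T|.

Definition ncopies (t T : bintree) : nat :=
  #|[pred u : vertex T | `[< matches_at t u >]]|.

Lemma addresses_uniq (T : bintree) : uniq (addresses T).
Proof.
elim: T => //= l IHl r IHr; rewrite cat_uniq mem_cat negb_or.
have inj b : injective (cons b : seq bool -> seq bool) by move=> a a' [].
rewrite !map_inj_uniq // IHl IHr /= andbT -andbA; apply/and3P; split.
- by apply/mapP => -[].
- by apply/mapP => -[].
- by apply/hasPn => _ /mapP[a _ ->]; apply/mapP => -[].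
Qed.

Lemma nverts_Leaf : nverts Leaf = 1%N.
Proof. by rewrite /nverts card_seq_sub. Qed.

Lemma nverts_Node (l r : bintree) :
  nverts (Node l r) = (nverts l + nverts r).+1.
Proof.
by rewrite /nverts !card_seq_sub ?addresses_uniq //= size_cat !size_map.
Qed.

(* Consequently the finitely supported sum in En below is a genuine sum. *)
Lemma finite_nverts (n : nat) : finite_set [set T | nverts T = n]%classic.
Proof.
suff fin m : finite_set [set T | (nverts T <= m)%N]%classic.
  by apply: sub_finite_set (fin n) => T /= ->.
elim: m => [|m IHm].
  apply: sub_finite_set (finite_set0 bintree) => -[|l r] /=.
    by rewrite nverts_Leaf.
  by rewrite nverts_Node.
have fin2 := finite_image2 Node IHm IHm.
apply: sub_finite_set
  (_ : finite_set ([set Leaf] `|` _)%classic); last first.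
  by rewrite finite_setU; split; [exact: finite_set1 | exact: fin2].
move=> [|l r] /=; first by left.
rewrite nverts_Node ltnS => le_m; right.
exists l; first exact: leq_trans (leq_addr _ _) le_m.
by exists r => //; exact: leq_trans (leq_addl _ _) le_m.
Qed.

Record fps (R : Type) := FPS { fps_coef :> nat -> R }.

HB.instance Definition _ (R : Type) := [isNew for @fps_coef R].
HB.instance Definition _ (R : choiceType) := [Choice of fps R by <:].

Section FPSRing.
Variable R : comNzRingType.
Implicit Types f g h : fps R.

Lemma fpsP f g : (forall n, f n = g n) -> f = g.
Proof. by case: f g => [f] [g] /= /funext ->. Qed.

Definition fps_zero : fps R := FPS (fun=> 0).
Definition fps_opp f : fps R := FPS (fun n => - f n).
Definition fps_add f g : fps R := FPS (fun n => f n + g n).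

Fact fps_addA : associative fps_add.
Proof. by move=> f g h; apply: fpsP => n /=; rewrite addrA. Qed.
Fact fps_addC : commutative fps_add.
Proof. by move=> f g; apply: fpsP => n /=; rewrite addrC. Qed.
Fact fps_add0 : left_id fps_zero fps_add.
Proof. by move=> f; apply: fpsP => n /=; rewrite add0r. Qed.
Fact fps_addN : left_inverse fps_zero fps_opp fps_add.
Proof. by move=> f; apply: fpsP => n /=; rewrite addNr. Qed.

HB.instance Definition _ :=
  GRing.isZmodule.Build (fps R) fps_addA fps_addC fps_add0 fps_addN.

Definition fps_one : fps R := FPS (fun n => (n == 0%N)%:R).
Definition fps_mul f g : fps R :=
  FPS (fun n => \sum_(i < n.+1) f i * g (n - i)%N).

Let trunc n f : {poly R} := \poly_(i < n.+1) f i.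

Let coef_trunc n f i : (i <= n)%N -> (trunc n f)`_i = f i.
Proof. by rewrite coef_poly ltnS => ->. Qed.

Let fps_mulE n f g i : (i <= n)%N ->
  fps_mul f g i = (trunc n f * trunc n g)`_i.
Proof.
move=> le_in; rewrite coefM; apply: eq_bigr => j _.
by rewrite !coef_trunc ?(leq_trans (leq_subr _ _)) // (leq_trans _ le_in) // -ltnS.
Qed.

Fact fps_mulA : associative fps_mul.
Proof.
move=> f g h; apply: fpsP => n.
transitivity ((trunc n f * (trunc n g * trunc n h))`_n).
  rewrite coefM; apply: eq_bigr => j _.
  by rewrite coef_trunc -1?ltnS // (fps_mulE (n := n)) // leq_subr.
rewrite mulrA coefM; apply: eq_bigr => j _.
by rewrite coef_trunc ?leq_subr // (fps_mulE (n := n)) // -ltnS.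
Qed.

Fact fps_mulC : commutative fps_mul.
Proof. by move=> f g; apply: fpsP => n; rewrite !(fps_mulE (n := n)) // mulrC. Qed.

Fact fps_mul1 : left_id fps_one fps_mul.
Proof.
move=> f; apply: fpsP => n /=; rewrite big_ord_recl /= mul1r subn0.
by rewrite big1 ?addr0 // => i _; rewrite mul0r.
Qed.

Fact fps_mulDl : left_distributive fps_mul fps_add.
Proof.
move=> f g h; apply: fpsP => n /=; rewrite -big_split /=.
by apply: eq_bigr => i _; rewrite mulrDl.
Qed.

Fact fps_one_neq0 : fps_one != 0.
Proof.
by apply/eqP => /(congr1 (fun f : fps R => f 0%N)) /eqP; rewrite /= oner_eq0.
Qed.

HB.instance Definition _ := GRing.Zmodule_isComNzRing.Build (fps R)
  fps_mulA fps_mulC fps_mul1 fps_mulDl fps_one_neq0.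

Definition fps_of_poly (p : {poly R}) : fps R := FPS (fun n => p`_n).

Fact fps_of_poly_is_zmod_morphism : zmod_morphism fps_of_poly.
Proof. by move=> p q; apply: fpsP => n /=; rewrite coefB. Qed.

Fact fps_of_poly_is_monoid_morphism : monoid_morphism fps_of_poly.
Proof.
by split=> [|p q]; apply: fpsP => n /=; rewrite ?coef1 ?coefM.
Qed.

HB.instance Definition _ := GRing.isZmodMorphism.Build {poly R} (fps R)
  fps_of_poly fps_of_poly_is_zmod_morphism.
HB.instance Definition _ := GRing.isMonoidMorphism.Build {poly R} (fps R)
  fps_of_poly fps_of_poly_is_monoid_morphism.

End FPSRing.

(* Q[[x, y]] is fps (fps rat) and Q[x, y] is {poly {poly rat}}: the outer
   variable is x, the inner one is y. *)
Definition fps2_of_poly2 (p : {poly {poly rat}}) : fps (fps rat) :=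
  fps_of_poly (map_poly (@fps_of_poly rat) p).

HB.instance Definition _ := GRing.RMorphism.copy fps2_of_poly2
  (@fps_of_poly (fps rat) \o map_poly (@fps_of_poly rat)).

Definition yvar : fps rat := fps_of_poly 'X.

Definition En (t : bintree) : fps (fps rat) :=
  FPS (fun n =>
    \sum_(T \in [set T : bintree | nverts T = n]%classic) yvar ^+ ncopies t T).

(* Main.v *)
Require Import Defs.
From HB Require Import structures.
From mathcomp Require Import all_boot all_order all_algebra.
From mathcomp Require Import boolp classical_sets fsbigop ring.

(* The set of subtrees of [t] that fit at the root of [T] is computed bottom-up
   by a finite automaton, and the copies of [t] are read off its states. Hence
   the generating functions [z_q] of the trees reaching the state [q] satisfy a
   system [z_q = x (a_q + sum b_(q,q1,q2) z_q1 z_q2)] over [Q[x, y]].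

   Solutions of such a system are algebraic. Deform it into
   [z_q = x (a_q + sum b_(q,q1,q2) z_q1 z_q2 + s z_q ^ 3)], which still has a
   power series solution. Every cube [z_q ^ 3] is now, up to the factor [s x], a
   combination of shorter monomials, so the monomials of degree at most [2 #|Q|]
   span a module stable under multiplication by [s x sum z_q]. The determinant
   trick gives a nonzero polynomial over [Q[x, y, s]] vanishing at [sum z_q];
   divide it by the largest possible power of [s] and put [s = 0]. *)

Import GRing.Theory.

Set Implicit Arguments.
Unset Strict Implicit.
Unset Printing Implicit Defensive.

Local Open Scope ring_scope.

(** * The determinant trick and cubic systems *)

(** The matrix [a - B] kills the vector of the [M i]. Multiplying by its adjugate shows that its
    determinant kills every [M i], in particular [M i0 = 1]. *)
Lemma ex_root_of_stable_span (C A : comNzRingType) (iota : {rmorphism C -> A})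
    (I : finType) (M : I -> A) (i0 : I) (a : A) (B : I -> I -> C) :
  M i0 = 1 -> (forall i, a * M i = \sum_j iota (B i j) * M j) ->
  exists2 p : {poly C}, p \is monic & (map_poly iota p).[a] = 0.
Proof.
move=> M1 aM; pose BI : 'M[C]_#|I| := \matrix_(i, j) B (enum_val i) (enum_val j).
exists (char_poly BI); first exact: char_poly_monic.
pose N : 'M[A]_#|I| := a%:M - map_mx iota BI.
have -> : (map_poly iota (char_poly BI)).[a] = \det N.
  rewrite -[LHS]/(horner_eval a _) map_char_poly -det_map_mx; congr (\det _).
  apply/matrixP => i j; rewrite !mxE /= /horner_eval.
  by rewrite hornerD hornerN hornerMn hornerX hornerC.
pose v : 'cV[A]_#|I| := \col_i M (enum_val i).
have Nv0 : N *m v = 0.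
  apply/matrixP => i j; rewrite mulmxBl mul_scalar_mx !mxE aM.
  apply/eqP; rewrite subr_eq0; apply/eqP.
  rewrite (reindex_onto (@enum_val I predT) enum_rank) => [|k _]; last first.
    by rewrite enum_rankK.
  by apply: eq_big => [k|k _]; rewrite ?enum_valK ?eqxx // !mxE.
have: (\det N *: v) (enum_rank i0) 0 = 0.
  by rewrite -mul_scalar_mx -mul_adj_mx -mulmxA Nv0 mulmx0 mxE.
by rewrite !mxE enum_rankK M1 mulr1.
Qed.

(** Pigeonhole: a word using each letter at most twice has length at most [2 * #|Q|]. *)
Lemma perm_cube_of_long (Q : finType) (w : seq Q) :
  (2 * #|Q| < size w)%N -> exists q w', perm_eq w [:: q, q, q & w'].
Proof.
move=> szw.
have [q lt2q]: exists q, (2 < count_mem q w)%N.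
  apply/existsP; apply: contraLR szw; rewrite negb_exists -leqNgt => /forallP le2.
  have -> : size w = (\sum_(q : Q) count_mem q w)%N.
    under eq_bigr do rewrite -sum1_count big_mkcond.
    rewrite exchange_big -sum1_size /=; apply: eq_bigr => q _ /=.
    by rewrite -big_mkcond (big_pred1 q) // => p; rewrite /= eq_sym.
  rewrite mulnC -sum_nat_const; apply: leq_sum => q _.
  by rewrite leqNgt.
have rem_step (u : seq Q) k : (k < count_mem q u)%N ->
    exists2 u', perm_eq u (q :: u') & (k <= count_mem q u')%N.
  move=> ltk; have qu : q \in u by rewrite -has_pred1 has_count (leq_ltn_trans _ ltk).
  exists (rem q u); first exact: perm_to_rem.
  by move: ltk; rewrite (permP (perm_to_rem qu)) /= eqxx.
have [u pu /rem_step[u' pu' /rem_step[u'' pu'' _]]] := rem_step _ _ lt2q.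
exists q, u''; apply: perm_trans pu _; rewrite perm_cons.
by apply: perm_trans pu' _; rewrite perm_cons.
Qed.

Section CubicSystem.
Variables (C : idomainType) (A : comNzRingType) (iota : {rmorphism C -> A}).
Variables (Q : finType) (Z : Q -> A) (c : C).
Variables (a : Q -> C) (b : Q -> Q -> Q -> C).

Let word (w : seq Q) : A := \prod_(q <- w) Z q.
(** Monomials are indexed by words; two words may give the same monomial, which is harmless for a
    spanning family. *)
Let in_span D (v : A) : Prop :=
  exists f : D.-bseq Q -> C, v = \sum_w iota (f w) * word w.

Let span_word D w : (size w <= D)%N -> in_span D (word w).
Proof.
move=> le_wD; exists (fun u => (u == Bseq le_wD)%:R).
rewrite (bigD1 (Bseq le_wD)) //= eqxx rmorph1 mul1r big1 ?addr0 // => u /negPf->.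
by rewrite rmorph0 mul0r.
Qed.

Let spanD D u v : in_span D u -> in_span D v -> in_span D (u + v).
Proof.
move=> [f ->] [g ->]; exists (fun w => f w + g w).
by rewrite -big_split; apply: eq_bigr => w _; rewrite rmorphD mulrDl.
Qed.

Let spanZ D k v : in_span D v -> in_span D (iota k * v).
Proof.
move=> [f ->]; exists (fun w => k * f w).
by rewrite mulr_sumr; apply: eq_bigr => w _; rewrite rmorphM mulrA.
Qed.

Let span_sum D (J : finType) (F : J -> A) :
  (forall j, in_span D (F j)) -> in_span D (\sum_j F j).
Proof.
move=> FD; apply: big_ind => // [|u v]; last exact: spanD.
by exists (fun=> 0); rewrite big1 // => w _; rewrite rmorph0 mul0r.
Qed.

(* Among words of length at most [2 * #|Q|], multiplication by a letter creates
   at worst a word containing a cube, which the system rewrites into shorter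
   words at the cost of the factor [c]. *)
Lemma cubic_system_algebraic : c != 0 ->
  (forall q, iota c * Z q ^+ 3 =
     Z q - iota (a q) - \sum_q1 \sum_q2 iota (b q q1 q2) * (Z q1 * Z q2)) ->
  exists2 p : {poly C}, p != 0 & (map_poly iota p).[\sum_q Z q] = 0.
Proof.
move=> c0 eqZ; set D := (2 * #|Q|)%N.
have wordM (q : Q) w : (size w <= D)%N -> in_span D (iota c * word (q :: w)).
  rewrite leq_eqVlt => /predU1P[szw | ltwD]; last exact/spanZ/span_word.
  have [|p [w' pw]] := @perm_cube_of_long Q (q :: w); first by rewrite /= szw.
  (* [q :: w] has length [D + 1], so removing the cube leaves [D - 2] letters and up to two can be
     put back. *)
  have szw' : D = (size w').+2 by case: (perm_size pw); rewrite szw.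
  have wd u : (size u <= 2)%N -> in_span D (word (u ++ w')).
    by move=> le2; apply: span_word; rewrite size_cat szw' -add2n leq_add2r.
  rewrite {1}/word (perm_big _ pw) /= !big_cons.
  rewrite -/(word w').
  have -> : iota c * (Z p * (Z p * (Z p * word w'))) =
      word ([:: p] ++ w') + iota (- a p) * word ([::] ++ w') +
      \sum_q1 \sum_q2 iota (- b p q1 q2) * word ([:: q1; q2] ++ w').
    transitivity (iota c * Z p ^+ 3 * word w'); first by ring.
    rewrite eqZ !mulrBl rmorphN mulNr; congr (_ + _).
      by rewrite /word big_cons.
    rewrite mulr_suml -sumrN; apply: eq_bigr => q1 _.
    rewrite mulr_suml -sumrN; apply: eq_bigr => q2 _.
    by rewrite rmorphN mulNr /word !big_cons !mulrA.
  apply: spanD; first by apply: spanD; [exact: wd | exact/spanZ/wd].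
  by apply: span_sum => q1; apply: span_sum => q2; exact/spanZ/wd.
have rows (w : D.-bseq Q) :
    in_span D (iota c * (\sum_q Z q) * word w).
  have -> : iota c * (\sum_q Z q) * word w = \sum_q iota c * word (q :: w).
    rewrite mulr_sumr mulr_suml; apply: eq_bigr => q _.
    by rewrite /word big_cons mulrA.
  by apply: span_sum => q; apply: wordM; exact: size_bseq.
have [B BE] := fin_all_exists rows.
have [|p p_monic pZ] :=
  @ex_root_of_stable_span _ _ iota _ (fun w : D.-bseq Q => word w) [bseq] _ B _ BE.
  by rewrite /word big_nil.
(* [p] vanishes at [iota c] times the sum; the substitution moves this factor into the
   polynomial. *)
exists (p \Po (c *: 'X)).
  by rewrite comp_poly2_eq0 ?monic_neq0 // size_scale ?size_polyX.
by rewrite map_comp_poly horner_comp map_polyZ map_polyX !hornerE.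
Qed.

End CubicSystem.

(** Once the variables are swapped, [k] is the multiplicity of the root 0 and the cofactor does not
    vanish there. *)
Lemma strip_factorX (R : idomainType) (P : {poly {poly R}}) : P != 0 ->
  exists k (P1 : {poly {poly R}}),
    P = 'X^k *: P1 /\ map_poly (horner_eval 0) P1 != 0.
Proof.
move=> P0; have [k [q]] := multiplicity_XsubC (swapXY P) 0.
rewrite swapXY_eq0 P0 subr0 /root => q0 eqP.
exists k, (swapXY q); split; last by rewrite -horner_swapXY swapXYK.
by rewrite -[P]swapXYK eqP rmorphM rmorphXn /= swapXY_X -mul_polyC rmorphXn mulrC.
Qed.

(** * Power series: truncation and fixed points *)

Definition map_fps (R S : Type) (f : R -> S) (a : fps R) : fps S :=
  FPS (fun n => f (a n)).

Section MapFps.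
Variables (R S : comNzRingType) (f : {rmorphism R -> S}).

Fact map_fps_is_zmod_morphism : zmod_morphism (map_fps f).
Proof. by move=> a b; apply: fpsP => n /=; rewrite rmorphB. Qed.

Fact map_fps_is_monoid_morphism : monoid_morphism (map_fps f).
Proof.
split=> [|a b]; apply: fpsP => n /=; first by rewrite rmorph_nat.
by rewrite rmorph_sum; apply: eq_bigr => i _; rewrite rmorphM.
Qed.

HB.instance Definition _ := GRing.isZmodMorphism.Build (fps R) (fps S)
  (map_fps f) map_fps_is_zmod_morphism.
HB.instance Definition _ := GRing.isMonoidMorphism.Build (fps R) (fps S)
  (map_fps f) map_fps_is_monoid_morphism.

End MapFps.

Section Truncation.
Variable R : comNzRingType.
Implicit Types f g : fps R.

Definition eq_upto m f g := forall n, (n < m)%N -> f n = g n.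

Lemma eq_uptoD m f g f' g' :
  eq_upto m f f' -> eq_upto m g g' -> eq_upto m (f + g) (f' + g').
Proof. by move=> ff gg n ltnm /=; rewrite ff ?gg. Qed.

Lemma eq_uptoM m f g f' g' :
  eq_upto m f f' -> eq_upto m g g' -> eq_upto m (f * g) (f' * g').
Proof.
move=> ff gg n ltnm; apply: eq_bigr => i _.
rewrite ff ?gg //; first exact: leq_ltn_trans (leq_subr _ _) ltnm.
by apply: leq_trans ltnm; exact: ltn_ord.
Qed.

Lemma eq_upto_sum m (I : finType) (F G : I -> fps R) :
  (forall i, eq_upto m (F i) (G i)) -> eq_upto m (\sum_i F i) (\sum_i G i).
Proof.
by move=> FG; apply: (big_ind2 (eq_upto m)) => // f f' g g'; exact: eq_uptoD.
Qed.

Lemma eq_uptoXM m f g :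
  eq_upto m f g -> eq_upto m.+1 (fps_of_poly 'X * f) (fps_of_poly 'X * g).
Proof.
move=> fg n ltnm; apply: eq_bigr => -[[|i] lti] _ /=.
  by rewrite coefX !mul0r.
congr (_ * _); apply: fg; rewrite ltnS in lti.
by rewrite -ltnS (leq_trans _ ltnm) // ltnS -subSn // subSS leq_subr.
Qed.

End Truncation.

Definition system_step (A : comNzRingType) (Q : finType) (x s : A) (a : Q -> A)
    (b : Q -> Q -> Q -> A) (z : Q -> A) (q : Q) : A :=
  x * (a q + \sum_q1 \sum_q2 b q q1 q2 * (z q1 * z q2) + s * z q ^+ 3).

(** Iterates from 0 use ring operations only. This relates the deformed system to its specialization
    at s = 0. *)
Lemma rmorph_iter_system_step (A B : comNzRingType) (f : {rmorphism A -> B})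
    (Q : finType) x s a b x' s' a' b' m (q : Q) :
  f x = x' -> f s = s' -> (forall p, f (a p) = a' p) ->
  (forall p p1 p2, f (b p p1 p2) = b' p p1 p2) ->
  f (iter m (system_step x s a b) (fun=> 0) q) =
  iter m (system_step x' s' a' b') (fun=> 0) q.
Proof.
move=> fx fs fa fb; elim: m q => [|m IHm] q; first exact: rmorph0.
rewrite !iterS /system_step rmorphM !rmorphD rmorphM rmorphXn rmorph_sum.
rewrite fx fs fa IHm; congr (_ * (_ + _ + _)).
apply: eq_bigr => q1 _; rewrite rmorph_sum.
by apply: eq_bigr => q2 _; rewrite !rmorphM fb !IHm.
Qed.

Section FixedPoint.
Variables (R : comNzRingType) (Q : finType) (s : fps R).
Variables (a : Q -> fps R) (b : Q -> Q -> Q -> fps R).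

Let step := system_step (fps_of_poly 'X) s a b.
Let approx m := iter m step (fun=> 0).

Let step_upto m z z' : (forall q, eq_upto m (z q) (z' q)) ->
  forall q, eq_upto m.+1 (step z q) (step z' q).
Proof.
move=> zz q; apply/eq_uptoXM/eq_uptoD; last first.
  by apply: eq_uptoM => //; do 2 apply: eq_uptoM => //.
apply: eq_uptoD => //; apply: eq_upto_sum => q1; apply: eq_upto_sum => q2.
by apply: eq_uptoM => //; exact: eq_uptoM.
Qed.

Let approx_upto m k q : eq_upto m (approx m q) (approx (m + k) q).
Proof. by elim: m q => [|m IHm] q //; exact: step_upto. Qed.

(** The factor x makes the step an x-adic contraction, so the iterates from 0 converge. *)
Lemma system_fixed_point : exists z : Q -> fps R,
  (forall q, z q = step z q) /\ forall m q, eq_upto m (z q) (approx m q).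
Proof.
(* Coefficient [n] no longer changes from iterate [n.+1] on, hence the diagonal. *)
pose z q := FPS (fun n => approx n.+1 q n).
have zE m q : eq_upto m (z q) (approx m q).
  move=> n ltnm; have := @approx_upto n.+1 (m - n.+1) q n (ltnSn n).
  by rewrite subnKC.
exists z; split=> // q; apply: fpsP => n.
rewrite (@zE n.+1) //; apply: step_upto (ltnSn n) => p k ltkn.
by rewrite -(@zE n).
Qed.

End FixedPoint.

(** * Deformation by s and return to s = 0 *)

(* The deformed series live in [Q[[y]][s][[x]]], whereas [s] is the outermost
   variable of [{poly {poly {poly rat}}}]. *)
Definition lift_xy : {poly {poly rat}} -> fps {poly fps rat} :=
  @fps_of_poly _ \o map_poly (polyC \o @fps_of_poly rat).
HB.instance Definition _ := GRing.RMorphism.copy lift_xy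
  (@fps_of_poly _ \o map_poly (polyC \o @fps_of_poly rat)).

Definition svar : fps {poly fps rat} := fps_of_poly 'X%:P.

Definition lift_sxy : {poly {poly {poly rat}}} -> fps {poly fps rat} :=
  horner_eval svar \o map_poly lift_xy.
HB.instance Definition _ := GRing.RMorphism.copy lift_sxy
  (horner_eval svar \o map_poly lift_xy).

(** Each coefficient in x is a polynomial in s, so s = 0 can be substituted coefficientwise. *)
Definition eval_s0 : fps {poly fps rat} -> fps (fps rat) :=
  map_fps (horner_eval 0).
HB.instance Definition _ := GRing.RMorphism.copy eval_s0
  (map_fps (horner_eval (0 : fps rat))).

Lemma lift_sxyC p : lift_sxy p%:P = lift_xy p.
Proof. by rewrite /lift_sxy /= map_polyC /horner_eval hornerC. Qed.

Lemma lift_sxyX : lift_sxy 'X = svar.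
Proof. by rewrite /lift_sxy /= map_polyX /horner_eval hornerX. Qed.

Lemma eval_s0_svar : eval_s0 svar = 0.
Proof.
apply: fpsP => n /=; rewrite coefC.
by case: eqP; rewrite /horner_eval ?hornerX ?horner0.
Qed.

Lemma eval_s0_lift_xy p : eval_s0 (lift_xy p) = fps2_of_poly2 p.
Proof.
apply: fpsP => n; apply: fpsP => k /=; rewrite !coef_map /=.
by rewrite /horner_eval hornerC.
Qed.

Lemma eval_s0_lift_sxy p :
  eval_s0 (lift_sxy p) = fps2_of_poly2 (horner_eval 0 p).
Proof.
elim/poly_ind: p => [|p c _]; first by rewrite !rmorph0.
rewrite !rmorphD !rmorphM /= lift_sxyC lift_sxyX eval_s0_svar mulr0 add0r.
by rewrite eval_s0_lift_xy /horner_eval hornerX hornerC rmorph0 mulr0 add0r.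
Qed.

(** Used to cancel the power of s taken out of the annihilating polynomial. *)
Lemma svarM_inj : injective ( *%R svar).
Proof.
have sE f n : (svar * f) n = 'X * f n.
  rewrite /= big_ord_recl coefC subn0 big1 ?addr0 // => i _.
  by rewrite coefC mul0r.
move=> f g eqfg; apply: fpsP => n; apply/polyP => i.
have := congr1 (fun h : fps {poly fps rat} => (h n)`_i.+1) eqfg.
by rewrite !sE !coefXM.
Qed.

Lemma quadratic_system_algebraic (Q : finType) (a : Q -> {poly {poly rat}})
    (b : Q -> Q -> Q -> {poly {poly rat}}) (F : fps (fps rat)) :
  (forall n, F n = (\sum_q iter n.+1 (system_step (fps2_of_poly2 'X) 0
     (fps2_of_poly2 \o a) (fun q q1 q2 => fps2_of_poly2 (b q q1 q2)))
     (fun=> 0) q) n) ->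
  exists P : {poly {poly {poly rat}}},
    P != 0 /\ (map_poly fps2_of_poly2 P).[F] = 0.
Proof.
move=> FE; have xE : lift_xy 'X = fps_of_poly 'X by rewrite /lift_xy /= map_polyX.
have [Z [Zfix Zapprox]] := system_fixed_point svar (lift_xy \o a)
  (fun q q1 q2 => lift_xy (b q q1 q2)).
(* Coefficient [n] is already that of iterate [n.+1], and iterates commute with [eval_s0]. *)
have FZ : eval_s0 (\sum_q Z q) = F.
  apply: fpsP => n; rewrite FE.
  have -> : eval_s0 (\sum_q Z q) n =
      eval_s0 (\sum_q iter n.+1 (system_step (lift_xy 'X) svar (lift_xy \o a)
        (fun q q1 q2 => lift_xy (b q q1 q2))) (fun=> 0) q) n.
    rewrite xE /=; congr (horner_eval 0 _).
    by apply: eq_upto_sum (ltnSn n) => q; exact: Zapprox.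
  congr (fps_coef _ n); rewrite rmorph_sum; apply: eq_bigr => q _.
  apply: rmorph_iter_system_step.
  - exact: eval_s0_lift_xy.
  - exact: eval_s0_svar.
  - by move=> p; exact: eval_s0_lift_xy.
  - by move=> p p1 p2; exact: eval_s0_lift_xy.
(* In ['X * x] the outer ['X] is s: the fixed point equation is read as s x z^3 = z - x a - x (sum
   of b z z). *)
pose x : {poly {poly {poly rat}}} := ('X)%:P.
have [||P P0 PZ] := @cubic_system_algebraic _ _ lift_sxy Q Z ('X * x)
  (fun q => x * (a q)%:P) (fun q q1 q2 => x * (b q q1 q2)%:P).
- by rewrite mulf_neq0 ?polyX_eq0 // polyC_eq0 polyX_eq0.
- move=> q; rewrite {2}Zfix /system_step -xE !rmorphM /= !lift_sxyC lift_sxyX.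
  rewrite !mulrDr mulr_sumr; set u := \sum_q1 _; set v := \sum_q1 _.
  have -> : u = v.
    apply: eq_bigr => q1 _; rewrite mulr_sumr; apply: eq_bigr => q2 _.
    by rewrite rmorphM /= !lift_sxyC mulrA.
  by rewrite /=; ring.
have [k [P1 [PE P1_0]]] := strip_factorX P0.
exists (map_poly (horner_eval 0) P1); split=> //.
have P1Z : (map_poly lift_sxy P1).[\sum_q Z q] = 0.
  move: PZ; rewrite PE map_polyZ rmorphXn /= lift_sxyX hornerZ.
  elim: k {PE} => [|k IHk]; first by rewrite mul1r.
  by rewrite exprS -mulrA -[RHS](mulr0 svar) => /svarM_inj.
have := congr1 eval_s0 P1Z.
rewrite -FZ rmorph0 -horner_map -!map_poly_comp => <-.
by congr (_.[_]); apply: eq_map_poly => p /=; rewrite eval_s0_lift_sxy.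
Qed.

(** * Generating functions of tree automata *)

(** Trees with at most [m] levels; the recursion runs in parallel with the iteration of the system
    from 0. *)
Fixpoint trees m : seq bintree :=
  if m is m'.+1 then
    Leaf :: [seq Node l r | l <- trees m', r <- trees m']
  else [::].

Lemma trees_uniq m : uniq (trees m).
Proof.
elim: m => //= m IHm; rewrite allpairs_uniq //; last by move=> [? ?] [? ?] _ _ [-> ->].
by rewrite andbT; apply/allpairsP => -[[l r] []].
Qed.

Lemma mem_trees m T : (nverts T <= m)%N -> T \in trees m.
Proof.
elim: m T => [|m IHm] [|l r]; rewrite ?nverts_Leaf ?nverts_Node ?mem_head //=.
rewrite ltnS inE => le_m; apply/orP; right; apply: allpairs_f; apply: IHm.
  exact: leq_trans (leq_addr _ _) le_m.
exact: leq_trans (leq_addl _ _) le_m.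
Qed.

Section Automaton.
Variables (Q : finType) (st : bintree -> Q) (delta : Q -> Q -> Q).
Variables (acc : Q -> bool) (cp : bintree -> nat).
Hypothesis st_Node : forall l r, st (Node l r) = delta (st l) (st r).
Hypothesis cp_Leaf : cp Leaf = acc (st Leaf).
Hypothesis cp_Node : forall l r,
  cp (Node l r) = (cp l + cp r + acc (st (Node l r)))%N.

Let mono (i j : nat) : {poly {poly rat}} := 'X^i * ('X^j)%:P.
Let weight T : fps (fps rat) := fps2_of_poly2 (mono (nverts T) (cp T)).

Let monoM i j i' j' : mono i j * mono i' j' = mono (i + i') (j + j').
Proof. by rewrite /mono !exprD rmorphM mulrACA. Qed.

Let monoX : 'X = mono 1 0.
Proof. by rewrite /mono expr1 mulr1. Qed.

Let weightE T n : weight T n = if nverts T == n then yvar ^+ cp T else 0.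
Proof.
rewrite /weight /mono /= coef_map /= mulrC coefCM coefXn eq_sym.
by case: eqP => _; rewrite ?mulr1 ?mulr0 ?rmorph0 ?rmorphXn.
Qed.

(** The new root contributes a factor y exactly when its state is accepting. *)
Let a q := (st Leaf == q)%:R * mono 0 (acc q).
Let b q q1 q2 := (delta q1 q2 == q)%:R * mono 0 (acc q).

Let step := system_step (fps2_of_poly2 'X) 0 (fps2_of_poly2 \o a)
  (fun q q1 q2 => fps2_of_poly2 (b q q1 q2)).

Let weight_Node l r : weight (Node l r) = fps2_of_poly2 'X *
  (fps2_of_poly2 (mono 0 (acc (st (Node l r)))) * (weight l * weight r)).
Proof.
rewrite /weight -!rmorphM /= monoX !monoM.
by rewrite nverts_Node cp_Node add1n !add0n (addnC _ (nat_of_bool _)).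
Qed.

Let sum_pick (p : Q) (v : fps (fps rat)) : \sum_q (p == q)%:R * v = v.
Proof.
rewrite (bigD1 p) //= eqxx mul1r big1 ?addr0 // => q.
by rewrite eq_sym => /negPf ->; rewrite mul0r.
Qed.

Let iter_stepE m q :
  iter m step (fun=> 0) q = \sum_(T <- trees m) (st T == q)%:R * weight T.
Proof.
elim: m q => [|m IHm] q; first by rewrite big_nil.
rewrite iterS /step /system_step mul0r addr0 /= big_cons big_allpairs_dep mulrDr.
congr (_ + _).
  rewrite /a rmorphM rmorph_nat mulrCA -rmorphM /=.
  case: eqP => [<-|_]; last by rewrite !mul0r.
  by rewrite /weight nverts_Leaf cp_Leaf monoX monoM.
(* [g] carries the indicators of the states of both subtrees; the sums over [q1] and [q2], moved
   innermost, each pick one state. *)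
pose g q1 q2 l r : fps (fps rat) := (st l == q1)%:R *
  ((st r == q2)%:R * ((st (Node l r) == q)%:R * weight (Node l r))).
transitivity (\sum_q1 \sum_q2 \sum_(l <- trees m) \sum_(r <- trees m) g q1 q2 l r).
  rewrite mulr_sumr; apply: eq_bigr => q1 _; rewrite mulr_sumr.
  apply: eq_bigr => q2 _; rewrite !IHm big_distrlr !mulr_sumr.
  apply: eq_bigr => l _; rewrite !mulr_sumr; apply: eq_bigr => r _.
  rewrite /g weight_Node st_Node /=.
  case: eqP => [<-|_]; last by rewrite !(mul0r, mulr0).
  case: eqP => [<-|_]; last by rewrite !(mul0r, mulr0).
  rewrite !mul1r /b rmorphM rmorph_nat; case: eqP => [<-|_]; last first.
    by rewrite !(mul0r, mulr0).
  by rewrite !mul1r.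
transitivity (\sum_q1 \sum_(l <- trees m) \sum_(r <- trees m) \sum_q2 g q1 q2 l r).
  apply: eq_bigr => q1 _; rewrite exchange_big; apply: eq_bigr => l _.
  by rewrite exchange_big.
rewrite exchange_big; apply: eq_bigr => l _.
rewrite exchange_big; apply: eq_bigr => r _.
under eq_bigr => q1 _ do rewrite /g -mulr_sumr sum_pick.
by rewrite sum_pick.
Qed.

Theorem automaton_algebraic (F : fps (fps rat)) :
  (forall n, F n =
     \sum_(T \in [set T : bintree | nverts T = n]%classic) yvar ^+ cp T) ->
  exists P : {poly {poly {poly rat}}},
    P != 0 /\ (map_poly fps2_of_poly2 P).[F] = 0.
Proof.
move=> FE; apply: (@quadratic_system_algebraic Q a b) => n; rewrite FE.
have -> : \sum_q iter n.+1 step (fun=> 0) q = \sum_(T <- trees n.+1) weight T.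
  under eq_bigr => q _ do rewrite iter_stepE.
  by rewrite exchange_big; apply: eq_bigr => T _; exact: sum_pick.
have: {subset [pred T | nverts T <= n]%N <= trees n.+1}.
  by move=> T le_n; apply: mem_trees; exact: leqW.
have: uniq (trees n.+1) by exact: trees_uniq.
(* The list may contain trees with other than [n] vertices: their weights have coefficient 0 at
   [n]. *)
move: (trees n.+1) => s s_uniq sP.
have -> : [set T | nverts T = n]%classic =
    [set` [seq T <- s | nverts T == n]]%classic.
  apply/seteqP; split=> T /=; rewrite mem_filter; last by case/andP => /eqP.
  by move=> nT; rewrite sP ?inE nT ?eqxx ?leqnn.
rewrite -fsbig_seq ?filter_uniq // big_filter big_mkcond.
elim: s {s_uniq sP} => [|T s IHs]; first by rewrite !big_nil.
by rewrite !big_cons IHs -weightE.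
Qed.

End Automaton.

(** * Copies of a pattern counted by an automaton *)

Fixpoint inner (T : bintree) (w : seq bool) : bool :=
  match T, w with
  | Leaf, _ => false
  | Node _ _, [::] => true
  | Node l r, d :: w' => inner (if d then r else l) w'
  end.

Lemma addresses_Node l r d w :
  (d :: w \in addresses (Node l r)) = (w \in addresses (if d then r else l)).
Proof.
have cons_inj e : injective (cons e : seq bool -> seq bool) by move=> ? ? [].
have cons_notin e (s : seq (seq bool)) : (~~ e :: w \in map (cons e) s) = false.
  by apply/mapP => -[? _ []]; case: e.
rewrite /= inE mem_cat /=; case: d.
  by rewrite (cons_notin false) mem_map.
by rewrite (cons_notin true) mem_map // orbF.
Qed.

Lemma rcons_addresses T w d : (rcons w d \in addresses T) = inner T w.
Proof.
elim: T w => [|l IHl r IHr] [|e w] //=; rewrite -/(addresses (Node l r)).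
  by rewrite addresses_Node; case: (d); case: l {IHl} => //; case: r {IHr}.
by rewrite addresses_Node; case: e.
Qed.

Lemma inner_addresses T w : inner T w -> w \in addresses T.
Proof.
elim: T w => [|l IHl r IHr] [|e w] //= Tw; rewrite -/(addresses (Node l r)).
by rewrite addresses_Node; case: e Tw => [/IHr | /IHl].
Qed.

Lemma internalE T (u : vertex T) : internal u = inner T (val u).
Proof.
apply/existsP/idP => [[d /existsP[v /eqP vE]] | uT].
  by rewrite -(rcons_addresses _ _ d) -vE; exact: valP.
have uT' : rcons (val u) false \in addresses T by rewrite rcons_addresses.
by exists false; apply/existsP; exists (SeqSub uT'); rewrite /is_child.
Qed.

(* The matching map is forced to be [w |-> u ++ w] on addresses. *)
Lemma matches_atP t T (u : vertex T) :
  matches_at t u <-> forall w, inner t w -> inner T (val u ++ w).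
Proof.
split=> [[phi [phi_root phi_inner]] | uT].
  have phiE w (tw : w \in addresses t) : val (phi (SeqSub tw)) = val u ++ w.
    (* Induction from the end of the address, since a child is reached by appending a turn. *)
    elim/last_ind: w tw => [|w d IHw] tw.
      rewrite cats0 -phi_root; congr (val (phi _)); exact: val_inj.
    have iw : inner t w by rewrite -(rcons_addresses _ _ d).
    have tw' := inner_addresses iw.
    have [|_ /(_ d (SeqSub tw))] := phi_inner (SeqSub tw'); first by rewrite internalE.
    by rewrite /is_child /= eqxx IHw rcons_cat => /(_ isT) /eqP.
  move=> w tw; rewrite -(phiE w (inner_addresses tw)) -internalE.
  by have [] := phi_inner (SeqSub (inner_addresses tw)); rewrite ?internalE.
have uwT w : w \in addresses t -> val u ++ w \in addresses T.
  case/lastP: w => [|w d]; first by rewrite cats0 => _; exact: valP.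
  by rewrite -rcons_cat !rcons_addresses; exact: uT.
exists (fun w => SeqSub (uwT _ (valP w))); split.
  by apply: val_inj; rewrite /= cats0.
move=> w; rewrite !internalE /= => /uT ->; split=> // d w' /eqP w'E.
by rewrite /is_child /= w'E rcons_cat.
Qed.

(** Matching at the root, in a form that splits over the two children as the automaton requires. *)
Fixpoint fits (s T : bintree) : bool :=
  match s, T with
  | Leaf, _ => true
  | Node a b, Node l r => fits a l && fits b r
  | Node _ _, Leaf => false
  end.

Lemma fitsP s T : reflect (forall w, inner s w -> inner T w) (fits s T).
Proof.
elim: s T => [|a IHa b IHb] [|l r] /=; try by constructor.
  by constructor => /(_ [::] isT).
apply: (iffP andP) => [[/IHa al /IHb br] [|[] w] // | sT]; [exact: br | exact: al |].
by split; [apply/IHa => w; exact: (sT (false :: w)) |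
           apply/IHb => w; exact: (sT (true :: w))].
Qed.

(** Counting along the list of addresses lets the count split at the root as [addresses] does. *)
Lemma ncopiesE t T : ncopies t T =
  count (fun a => `[< forall w, inner t w -> inner T (a ++ w) >]) (addresses T).
Proof.
rewrite -(val_seq_sub_enum (addresses_uniq T)) count_map /ncopies cardE.
rewrite /enum_mem size_filter unlock; apply: eq_count => u /=.
by apply: asbool_equiv_eq; exact: matches_atP.
Qed.

Lemma ncopies_Leaf t : ncopies t Leaf = fits t Leaf.
Proof. by rewrite ncopiesE /= addn0; congr nat_of_bool; apply/asboolP/fitsP. Qed.

Lemma ncopies_Node t l r :
  ncopies t (Node l r) = (ncopies t l + ncopies t r + fits t (Node l r))%N.
Proof.
rewrite !ncopiesE /= count_cat !count_map addnC; congr (_ + _ + _)%N.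
by congr nat_of_bool; apply/asboolP/fitsP.
Qed.

Fixpoint subtrees (s : bintree) : seq bintree :=
  s :: (if s is Node a b then subtrees a ++ subtrees b else [::]).

Lemma mem_subtrees t : t \in subtrees t.
Proof. by case: t => *; exact: mem_head. Qed.

(** Closure under children is what makes the states of two trees determine the state of their
    [Node]. *)
Lemma subtrees_Node t a b :
  Node a b \in subtrees t -> a \in subtrees t /\ b \in subtrees t.
Proof.
elim: t => [|l IHl r IHr] //=; rewrite !inE !mem_cat => /predU1P[[-> ->] | ].
  by rewrite !mem_subtrees !orbT.
by case/orP => [/IHl[-> ->] | /IHr[-> ->]]; rewrite !orbT.
Qed.

Theorem theorem1 (t : bintree) :
  exists P : {poly {poly {poly rat}}},
    P != 0 /\ (map_poly fps2_of_poly2 P).[En t] = 0.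
Proof.
(* A state is the bit vector of the subtrees of [t] that fit at the root; a repeated subtree is read
   at its first position. *)
pose Q := (size (subtrees t)).-tuple bool.
pose st T : Q := map_tuple (fun s => fits s T) (in_tuple (subtrees t)).
pose at_ (q : Q) s := nth false q (index s (subtrees t)).
(* The value [true] is for the one-vertex subtree, a blank that fits everywhere. *)
pose delta q1 q2 : Q := map_tuple
  (fun s => if s is Node a b then at_ q1 a && at_ q2 b else true)
  (in_tuple (subtrees t)).
have at_st s T : s \in subtrees t -> at_ (st T) s = fits s T.
  by move=> ts; rewrite /at_ (nth_map Leaf) ?index_mem // nth_index.
apply: (@automaton_algebraic Q st delta (fun q => at_ q t) (ncopies t)).
- move=> l r; apply/val_inj/eq_in_map => -[|a b] //= /subtrees_Node[ta tb].
  by rewrite !at_st.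
- by rewrite ncopies_Leaf at_st ?mem_subtrees.
- by move=> l r; rewrite ncopies_Node at_st ?mem_subtrees.
- by [].
Qed.
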